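(* For every positive integer $k$ (and $n\ge k$), there is a symmetric $\mathbb{F}_2$-polynomial $p(x_1,\dots,x_n)$ of degree $d=\Theta(\sqrt{kn})$ such that \[ L_{1,k}(p)\;\ge\;\frac{e^{-k}}{2}\binom{n}{k}^{1/2}=\Omega_k(1)\cdot d^k . \]
   Context: An $\mathbb{F}_2$-polynomial is symmetric if its value depends only on the Hamming weight of its input $x\in\{0,1\}^n$. For a Boolean function $p$ on $\{0,1\}^n$ and $S\subseteq[n]$, $\hat p(S)=\mathbb{E}_{x}[p(x)(-1)^{\sum_{i\in S}x_i}]$ for uniform $x$, and $L_{1,k}(p)=\sum_{|S|=k}|\hat p(S)|$. $\Omega_k(1)$ denotes a positive quantity depending only on $k$. *)

(* Defs.v *)
From HB Require Import structures.
From mathcomp Require Import all_boot all_order all_algebra.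
From mathcomp Require Import reals.
From mathcomp Require sequences exp.
From mathcomp Require Import mpoly.

Set Implicit Arguments.
Unset Strict Implicit.
Unset Printing Implicit Defensive.

Import Order.TTheory GRing.Theory Num.Theory.
Local Open Scope ring_scope.

Definition cube (n : nat) := {ffun 'I_n -> bool}.

Definition hamming_weight n (x : cube n) : nat := (\sum_(i < n) x i)%N.

Definition f2eval n (p : {mpoly 'F_2[n]}) (x : cube n) : 'F_2 :=
  p.@[fun i => (x i)%:R].

(* An F_2-polynomial is a multilinear one (reduced modulo x_i^2 = x_i), so that
   its degree is that of the Boolean function it computes; without this
   restriction the degree of a representative could be inflated at will. *)
Definition multilinear n (p : {mpoly 'F_2[n]}) : Prop :=
  forall m : 'X_{1..n}, m \in msupp p -> forall i, (m i <= 1)%N.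

(* [msize] is the total degree plus one, and 0 on the zero polynomial. *)
Definition f2degree n (p : {mpoly 'F_2[n]}) : nat := (msize p).-1.

Definition f2symmetric n (p : {mpoly 'F_2[n]}) : Prop :=
  forall x y : cube n,
    hamming_weight x = hamming_weight y -> f2eval p x = f2eval p y.

(* The Boolean function of p, with F_2 = {0,1} seen inside R: values are 0 and
   1, not signs.  For nonempty S the coefficients of (-1)^p are -2 times those
   of this function. *)
Definition f2fun (R : realType) n (p : {mpoly 'F_2[n]}) (x : cube n) : R :=
  (f2eval p x != 0)%:R.

Definition fourier (R : realType) n (f : cube n -> R) (S : {set 'I_n}) : R :=
  (\sum_(x : cube n) f x * (-1) ^+ (\sum_(i in S) x i)%N) / (2 ^ n)%:R.

Definition L1 (R : realType) n (k : nat) (f : cube n -> R) : R :=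
  \sum_(S : {set 'I_n} | #|S| == k) `|fourier f S|.

(* Main.v *)
Require Import Defs.
From HB Require Import structures.
From mathcomp Require Import all_boot all_order all_algebra.
From mathcomp Require Import reals.
From mathcomp Require sequences exp.
From mathcomp Require Import mpoly.
From mathcomp Require Import zify ring lra.
From mathcomp Require complex derive trigo normed_module.

Import normed_module.numFieldNormedType.Exports.
Import complex.ComplexField.
Import Order.TTheory GRing.Theory Num.Theory.
Local Open Scope ring_scope.

(* Let [N = 2 ^ t] be of order [sqrt (k n)].  A function of the Hamming weight
   modulo [N] is a symmetric F_2-polynomial of degree less than [N], by Newton
   interpolation and [(E - 1) ^ N = E ^ N - 1] in characteristic 2 ([E] the
   shift).  Let [a_r] be the sum over [|S| = k] and over the [x] of weight [r]
   modulo [N] of the characters [chi_S(x)].  The [a_r] sum to 0, so the 0/1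
   function [r |-> [a_r > 0]] has level-k mass at least [A / 2 ^ (n+1)], where
   [A] is the sum of the [|a_r|].  For every N-th root of unity [z],
     [A >= |sum_r a_r z ^ r| = 'C(n, k) |1 - z| ^ k |1 + z| ^ (n - k)],
   and taking [|1 - z| / 2] close to [sqrt (k / n)] makes the right-hand side at
   least a constant times [2 ^ n e^(-k/2) 'C(n, k)^(1/2)].  The factor
   [e^(k/2)] gained on the claim pays for flipping the value on one residue
   class, which makes the coefficient of the elementary symmetric polynomial of
   degree [2 ^ s - 1] nonzero and so forces the lower bound on the degree. *)

(** * Newton expansion over F_2 *)

Definition fdiff (F : nat -> 'F_2) (w : nat) : 'F_2 := F w.+1 + F w.

Lemma addrr_F2 (a : 'F_2) : a + a = 0.
Proof. by rewrite -mulr2n -mulr_natr (pchar_Zp (isT : (1 < 2)%N)) mulr0. Qed.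

(** Since [F w.+1 = fdiff F w + F w], the induction hypothesis at [F] and at [fdiff F] combine
    through Pascal's rule. *)
Lemma newton_expansion (F : nat -> 'F_2) (m w : nat) : (w <= m)%N ->
  F w = \sum_(j < m.+1) iter j fdiff F 0 *+ 'C(w, j).
Proof.
elim: w m F => [|w IH] m F lewm.
  by rewrite big_ord_recl bin0 mulr1n big1 ?addr0 // => j _; rewrite bin0n.
case: m lewm => // m lewm.
have -> : F w.+1 = fdiff F w + F w by rewrite /fdiff -addrA addrr_F2 addr0.
rewrite (IH m.+1 F) 1?leqW // (IH m (fdiff F)) //.
rewrite [X in _ + X]big_ord_recl [in RHS]big_ord_recl !bin0.
rewrite addrCA -big_split /=; congr (_ + _); apply: eq_bigr => j _.
by rewrite -iterSr /= binS mulrnDr addrC.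
Qed.

Lemma iter_fdiff_exp2 t (F : nat -> 'F_2) w :
  iter (2 ^ t) fdiff F w = F (w + 2 ^ t)%N + F w.
Proof.
elim: t F w => [|t IH] F w; first by rewrite /= addn1.
rewrite expnS mul2n -addnn iterD !IH addnA -addrA.
by rewrite [X in _ + X]addrA addrr_F2 add0r.
Qed.

Lemma iter_fdiff_periodic t (F : nat -> 'F_2) j w :
  (forall w, F (w + 2 ^ t)%N = F w) -> (2 ^ t <= j)%N -> iter j fdiff F w = 0.
Proof.
move=> perF /subnK <-; elim: (j - 2 ^ t)%N w => [|i IH] w.
  by rewrite add0n iter_fdiff_exp2 perF addrr_F2.
by rewrite addSn /= /fdiff !IH addr0.
Qed.

(** Doubling: (E + 1)^(2^(s+1) - 1) = (E^(2^s) + 1) (E + 1)^(2^s - 1), with E the shift. At [w = 0],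
    flipping one of the first [2 ^ s] values of [F] therefore toggles the coefficient of degree
    [2 ^ s - 1]. *)
Lemma iter_fdiff_pred_exp2 s (F : nat -> 'F_2) w :
  iter (2 ^ s).-1 fdiff F w = \sum_(i < 2 ^ s) F (w + i)%N.
Proof.
elim: s w => [|s IH] w; first by rewrite big_ord1 addn0.
have -> : (2 ^ s.+1).-1 = (2 ^ s + (2 ^ s).-1)%N.
  by rewrite expnS mul2n -addnn; have := expn_gt0 2 s; lia.
rewrite iterD iter_fdiff_exp2 !IH expnS mul2n -addnn big_split_ord /= addrC.
by congr (_ + _); apply: eq_bigr => i _; rewrite addnA.
Qed.

(** * Symmetric multilinear polynomials *)

Lemma hamming_weight_card n (x : cube n) :
  hamming_weight x = #|[set i | x i]|.
Proof.
rewrite /hamming_weight -sum1_card big_mkcond [RHS]big_mkcond /=.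
by apply: eq_bigr => i _; rewrite inE; case: (x i).
Qed.

(** On a 0/1 point the monomial of [h] is 1 exactly when [h] lies in the support, so the value
    counts the [j]-subsets of the support. *)
Lemma f2eval_mesym n j (x : cube n) :
  f2eval (mesym n 'F_2 j) x = 'C(hamming_weight x, j)%:R.
Proof.
rewrite /f2eval /mesym rmorph_sum /= hamming_weight_card -cards_draws.
rewrite -sum1_card natr_sum big_mkcond [RHS]big_mkcond /=.
apply: eq_bigr => h _; rewrite inE andbC; case: eqP => //= _.
rewrite rmorph_prod /=.
case: ifPn => [/subsetP sub|].
  by rewrite big1 // => i /sub; rewrite inE mevalXU => ->.
case/subsetPn => i hi; rewrite inE => /negbTE xi.
by rewrite (bigD1 i) //= mevalXU xi mul0r.
Qed.

Definition sympoly n (F : nat -> 'F_2) : {mpoly 'F_2[n]} :=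
  \sum_(j < n.+1) iter j fdiff F 0 *: mesym n 'F_2 j.

Lemma f2eval_sympoly n F (x : cube n) : f2eval (sympoly n F) x = F (hamming_weight x).
Proof.
rewrite (newton_expansion F n); last first.
  by rewrite hamming_weight_card (leq_trans (max_card _)) ?card_ord.
rewrite /f2eval /sympoly rmorph_sum /=; apply: eq_bigr => j _.
by rewrite mevalZ -/(f2eval _ x) f2eval_mesym mulr_natr.
Qed.

Lemma mcoeff_sympoly n F (m : 'X_{1..n}) :
  (sympoly n F)@_m =
  if [forall i, (m i <= 1)%N] then iter (mdeg m) fdiff F 0 else 0.
Proof.
rewrite /sympoly raddf_sum /=.
under eq_bigr do rewrite mcoeffZ mcoeff_mesym /mechar.
case: ifPn => [/forallP m1|_]; last first.
  by rewrite big1 // => j _; rewrite andbF mulr0.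
have lemn : (mdeg m < n.+1)%N.
  rewrite ltnS mdegE -[leqRHS]card_ord -sum1_card.
  by apply: leq_sum => i _; apply: m1.
rewrite (bigD1 (Ordinal lemn)) //= eqxx mulr1 big1 ?addr0 // => j.
by rewrite -val_eqE /= eq_sym => /negbTE ->; rewrite mulr0.
Qed.

Lemma sympoly_multilinear n F : multilinear (sympoly n F).
Proof.
move=> m; rewrite mcoeff_msupp mcoeff_sympoly.
by case: ifPn => [/forallP|]; rewrite ?eqxx.
Qed.

Lemma sympoly_symmetric n F : f2symmetric (sympoly n F).
Proof. by move=> x y; rewrite !f2eval_sympoly => ->. Qed.

Lemma f2degree_sympoly_lt n F t :
  (forall w, F (w + 2 ^ t)%N = F w) -> (f2degree (sympoly n F) < 2 ^ t)%N.
Proof.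
move=> perF; have : (msize (sympoly n F) <= 2 ^ t)%N.
  rewrite msizeE; apply/bigmax_leqP_seq => m + _.
  rewrite mcoeff_msupp mcoeff_sympoly; case: ifP; rewrite ?eqxx // => _.
  by rewrite ltnNge; apply: contra => le; rewrite (iter_fdiff_periodic t).
by rewrite /f2degree; have := expn_gt0 2 t; lia.
Qed.

Lemma f2degree_sympoly_ge n F j :
  (j <= n)%N -> iter j fdiff F 0 != 0 -> (j <= f2degree (sympoly n F))%N.
Proof.
move=> lejn nz; have [h ch] : exists h : {set 'I_n}, #|h| = j.
  have /card_gt0P[h] :
      (0 < #|[set A : {set 'I_n} | (A \subset [set: 'I_n]) && (#|A| == j)]|)%N.
    by rewrite cards_draws cardsT card_ord bin_gt0.
  by rewrite inE => /andP[_ /eqP ch]; exists h.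
have : mesym1 h \in msupp (sympoly n F).
  rewrite mcoeff_msupp mcoeff_sympoly mdeg_mesym1 ch ifT //.
  by apply/forallP => i; rewrite mnmE; case: (_ \in _).
by move/msize_mdeg_lt; rewrite mdeg_mesym1 ch /f2degree; lia.
Qed.

(** * Character sums over weight classes *)

(** The summand is a product over coordinates; summing over bit [i] gives [1 - z] if [i] is in [S]
    and [1 + z] otherwise. *)
Lemma character_sum (A : comPzRingType) n (S : {set 'I_n}) (z : A) :
  \sum_(x : cube n) (-1) ^+ (\sum_(i in S) x i)%N * z ^+ hamming_weight x
  = (1 - z) ^+ #|S| * (1 + z) ^+ (n - #|S|).
Proof.
pose G (i : 'I_n) (b : bool) : A := (if i \in S then (-1) ^+ b else 1) * z ^+ b.
transitivity (\sum_(x : cube n) \prod_i G i (x i)).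
  apply: eq_bigr => x _; rewrite /G big_split /=; congr (_ * _).
    by rewrite -big_mkcond /= -expr_sum.
  by rewrite -expr_sum.
rewrite -bigA_distr_bigA /=.
transitivity (\prod_i (if i \in S then 1 - z else 1 + z)).
  apply: eq_bigr => i _; rewrite big_bool /G.
  by case: ifP => _; rewrite !expr0 !expr1 ?mulN1r ?mul1r addrC.
rewrite (bigID (mem S)) /=; congr (_ * _).
  by rewrite -prodr_const; apply: eq_bigr => i ->.
have -> : (n - #|S| = #|~: S|)%N by have := cardsC S; rewrite card_ord; lia.
rewrite -prodr_const.
by apply: eq_big => [i|i /negbTE -> //]; rewrite inE.
Qed.

(** For fixed [x], the sum over [S] is the [k]-th Krawtchouk polynomial at the weight of [x].
    Integer values can be cast both to the reals and to the complex numbers. *)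
Definition krawtchouk_class (n k N r : nat) : int :=
  \sum_(S : {set 'I_n} | #|S| == k)
    \sum_(x : cube n | (hamming_weight x %% N)%N == r)
      (-1) ^+ (\sum_(i in S) x i)%N.

Lemma sum_krawtchouk_class (A : pzRingType) n k N (g : nat -> A) : (0 < N)%N ->
  \sum_(r < N) (krawtchouk_class n k N r)%:~R * g r =
  \sum_(S : {set 'I_n} | #|S| == k) \sum_(x : cube n)
      (-1) ^+ (\sum_(i in S) x i)%N * g (hamming_weight x %% N)%N.
Proof.
move=> N0; under eq_bigr do rewrite /krawtchouk_class rmorph_sum mulr_suml.
rewrite exchange_big /=; apply: eq_bigr => S _.
rewrite (partition_big (fun x => Ordinal (ltn_pmod (hamming_weight x) N0)) predT) //=.
apply: eq_bigr => r _; rewrite rmorph_sum mulr_suml /=.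
by apply: eq_big => [x|x /eqP <-]; rewrite ?rmorphXn ?rmorphN1.
Qed.

Lemma krawtchouk_class_root (A : comPzRingType) n k N (z : A) :
  (0 < N)%N -> z ^+ N = 1 ->
  \sum_(r < N) (krawtchouk_class n k N r)%:~R * z ^+ r =
  ((1 - z) ^+ k * (1 + z) ^+ (n - k)) *+ 'C(n, k).
Proof.
move=> N0 zN; rewrite (sum_krawtchouk_class A n k N (fun r => z ^+ r)) //.
have zmod w : z ^+ (w %% N) = z ^+ w.
  by rewrite [in RHS](divn_eq w N) exprD mulnC exprM zN expr1n mul1r.
rewrite -[n in 'C(n, k)]card_ord -card_draws -sum1_card -sumrMnr.
rewrite [RHS]big_mkcond [LHS]big_mkcond /=; apply: eq_bigr => S _.
rewrite inE; case: eqP => // <-.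
by under eq_bigr do rewrite zmod; rewrite character_sum.
Qed.

Lemma sum_krawtchouk_class0 (A : comPzRingType) n k N : (0 < N)%N -> (0 < k)%N ->
  \sum_(r < N) (krawtchouk_class n k N r)%:~R = 0 :> A.
Proof.
move=> N0 k0; have := krawtchouk_class_root A n k N 1 N0 (expr1n _ _).
rewrite subrr expr0n gtn_eqF // mul0r mul0rn => e; rewrite -[RHS]e.
by apply: eq_bigr => r _; rewrite expr1n mulr1.
Qed.

(** The left-hand side is the signed sum of the level-[k] Fourier coefficients. *)
Lemma L1_krawtchouk_class (R : realType) n k N (p : {mpoly 'F_2[n]})
    (F : nat -> 'F_2) : (0 < N)%N ->
  (forall x, f2eval p x = F (hamming_weight x %% N)%N) ->
  (\sum_(r < N) (krawtchouk_class n k N r)%:~R * (F r != 0)%:R) / (2 ^ n)%:R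
  <= L1 k (f2fun R p).
Proof.
move=> N0 pF; rewrite (sum_krawtchouk_class R n k N (fun r => (F r != 0)%:R)) //.
rewrite mulr_suml; apply: le_trans (ler_norm _) _.
apply: le_trans (ler_norm_sum _ _ _) _; rewrite /L1 le_eqVlt; apply/orP; left.
apply/eqP; apply: eq_bigr => S _; rewrite /fourier; congr `|_ / _|.
by apply: eq_bigr => x _; rewrite mulrC /f2fun pF.
Qed.

Lemma sum_abs_krawtchouk_class (R : realType) n k N (z : complex.complex R) (u v : R) :
  (0 < N)%N -> z ^+ N = 1 ->
  `|1 - z| = complex.real_complex R u -> `|1 + z| = complex.real_complex R v ->
  'C(n, k)%:R * (u ^+ k * v ^+ (n - k))
  <= \sum_(r < N) `|(krawtchouk_class n k N r)%:~R| :> R.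
Proof.
move=> N0 zN zu zv; rewrite -complex.lecR.
have z1 : `|z| = 1.
  by apply/eqP; rewrite -(@pexpr_eq1 _ _ N) // -normrX zN normr1.
have /(congr1 Num.norm) := krawtchouk_class_root _ n k N z N0 zN.
rewrite -mulr_natl !normrM !normrX zu zv normr_nat => e.
rewrite !rmorphM !rmorphXn /= rmorph_nat -e rmorph_sum /=.
apply: le_trans (ler_norm_sum _ _ _) _; apply: ler_sum => r _.
rewrite normrM normrX z1 expr1n mulr1 -!intr_norm.
by rewrite rmorph_int.
Qed.

(** * Choice of the values of the polynomial *)

(** Termwise, twice the positive part of [a r] is [a r + |a r|], and the [a r] sum to 0. *)
Lemma sum_positive_part (R : realFieldType) N (a : nat -> R) :
  \sum_(r < N) a r = 0 ->
  \sum_(r < N) a r * (0 < a r)%R%:R = (\sum_(r < N) `|a r|) / 2.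
Proof.
move=> a0; suff: (\sum_(r < N) a r * (0 < a r)%R%:R) *+ 2 = \sum_(r < N) `|a r|.
  by move=> <-; rewrite -mulr_natr mulfK // pnatr_eq0.
rewrite -[RHS]addr0 -[X in _ + X]a0 -big_split -sumrMnl /=; apply: eq_bigr => r _.
case: ltrP => [a_gt0|a_le0]; first by rewrite gtr0_norm // mulr1 mulr2n.
by rewrite ler0_norm // mulr0 addNr mul0rn.
Qed.

Lemma exists_le_average (R : realFieldType) M (b : nat -> R) : (0 < M)%N ->
  exists2 r, (r < M)%N & b r <= (\sum_(i < M) b i) / M%:R.
Proof.
case: M => // M _.
case: (arg_minP (fun i : 'I_M.+1 => b i) (erefl true : predT ord0)) => i _ mi.
exists i => //; rewrite ler_pdivlMr ?ltr0n // mulr_natr -[X in b i *+ X]card_ord.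
by rewrite -sumr_const; apply: ler_sum => j _; apply: mi.
Qed.

(* Flipping the value on one class of below-average weight costs at most a
   fraction 1/M of the total. *)
Lemma odd_selection (R : realFieldType) N M (a : nat -> R) :
  (0 < M <= N)%N -> \sum_(r < N) a r = 0 ->
  exists f : nat -> bool, \sum_(r < M) (f r)%:R != 0 :> 'F_2 /\
    (\sum_(r < N) `|a r|) * (2^-1 - M%:R^-1) <= \sum_(r < N) a r * (f r)%:R.
Proof.
move=> /andP[M0 MN] a0; pose f0 r := 0 < a r.
have [f0M|f0M] := eqVneq (\sum_(r < M) (f0 r)%:R : 'F_2) 0; last first.
  exists f0; split=> //; rewrite sum_positive_part // ler_wpM2l ?sumr_ge0 //.
  by rewrite gerBl invr_ge0 ler0n.
have [r0 r0M ar0] := exists_le_average R M (fun r => `|a r|) M0.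
have r0N := leq_trans r0M MN.
exists (fun r => (r == r0) (+) f0 r); split.
  have e (r : 'I_M) :
      ((r == r0 :> nat) (+) f0 r)%:R = (r == Ordinal r0M)%:R + (f0 r)%:R :> 'F_2.
    rewrite -val_eqE /=.
    by case: eqP => _; case: (f0 r); rewrite /= ?addrr_F2 ?addr0 ?add0r.
  under eq_bigr do rewrite e.
  rewrite big_split /= f0M addr0 (bigD1 (Ordinal r0M)) //= eqxx.
  by rewrite big1 ?addr0 // => r /negbTE ->.
rewrite mulrBr -sum_positive_part //.
apply: (@le_trans _ _ (\sum_(r < N) a r * (0 < a r)%R%:R - `|a r0|)).
  rewrite lerD2l lerN2; apply: le_trans ar0 _.
  rewrite ler_wpM2r ?invr_ge0 ?ler0n //.
  rewrite -(big_mkord predT (fun r => `|a r|)) -(big_mkord predT (fun r => `|a r|)).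
  by rewrite (big_cat_nat (leq0n M) MN) //= lerDl sumr_ge0.
rewrite [leRHS](bigD1 (Ordinal r0N)) //= [in leLHS](bigD1 (Ordinal r0N)) //= eqxx.
rewrite addrAC; apply: lerD.
  rewrite /f0; case: ltrP => h /=; first by rewrite gtr0_norm // mulr1 subrr mulr0.
  by rewrite ler0_norm // mulr0 mulr1 opprK add0r.
by apply: ler_sum => r; rewrite -val_eqE /= => /negbTE ->.
Qed.

(** * Roots of unity near a prescribed point *)

Lemma sin_le_id (R : realType) (x : R) : 0 <= x -> trigo.sin x <= x.
Proof.
move=> x0; have [|c _] := @derive.MVT_segment R trigo.sin trigo.cos 0 x x0.
  by apply: subspace_topology.continuous_subspaceT => y; apply: trigo.continuous_sin.
rewrite trigo.sin0 !subr0 => ->.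
by rewrite ler_piMl // trigo.cos_le1.
Qed.

Definition cis (R : realType) (x : R) : complex.complex R :=
  complex.Complex (trigo.cos x) (trigo.sin x).

Lemma cisX (R : realType) (x : R) m : cis R x ^+ m = cis R (x *+ m).
Proof.
elim: m => [|m IH]; first by rewrite mulr0n /cis trigo.cos0 trigo.sin0.
rewrite exprS IH mulrS /cis trigo.cosD trigo.sinD.
by congr complex.Complex; rewrite addrC.
Qed.

(** With h = pi / N and z = exp(2 i m h), |1 - z| = 2 |sin(m h)| and |1 + z| = 2 |cos(m h)|. As [m]
    grows by one, |sin(m h)| grows by at most h <= 4 / N; take the last [m] before it first reaches
    [s]. *)
Lemma root_of_unity_near (R : realType) N (s : R) :
  (0 < N)%N -> ~~ odd N -> 0 < s <= 1 ->
  exists (z : complex.complex R) (u v : R),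
  [/\ z ^+ N = 1, `|1 - z| = complex.real_complex R (2 * u),
      `|1 + z| = complex.real_complex R (2 * v), s - 4 / N%:R <= u <= s &
      0 <= v /\ u ^+ 2 + v ^+ 2 = 1].
Proof.
move=> N0 evN /andP[s0 s1].
have Nr0 : N%:R != 0 :> R by rewrite pnatr_eq0 -lt0n.
pose h : R := trigo.pi / N%:R.
have hN : h *+ N = trigo.pi by rewrite -mulr_natr divfK.
have h0 : 0 <= h by rewrite divr_ge0 // trigo.pi_ge0.
have h4 : h <= 4 / N%:R.
  by rewrite ler_wpM2r ?invr_ge0 ?ler0n //; have := trigo.pihalf_lt2 R; lra.
have hh : 0 <= trigo.sin h.
  rewrite trigo.sin_ge0_pi // h0 ler_pdivrMr ?ltr0n // ler_peMr ?trigo.pi_ge0 //.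
  by rewrite ler1n.
pose a m := `|trigo.sin (h *+ m)|.
(* As [N] is even, [m = N / 2] gives the angle pi / 2, whose sine is 1. *)
have ex : exists m, s <= a m.
  exists N./2; rewrite /a; have -> : h *+ N./2 = trigo.pi / 2.
    rewrite -hN -[in RHS](even_halfK evN) -muln2 mulrnA.
    by rewrite -(mulr_natr (h *+ N./2) 2) mulfK // pnatr_eq0.
  by rewrite trigo.sin_pihalf normr1.
case: (ex_minnP ex) => -[|m] sm minm.
  by move: sm; rewrite /a mulr0n trigo.sin0 normr0 leNgt s0.
have am : a m < s by rewrite ltNge; apply/negP => /minm; rewrite ltnn.
have stepm : a m.+1 <= a m + h.
  rewrite /a mulrSr trigo.sinD; apply: le_trans (ler_normD _ _) _.
  rewrite !normrM; apply: lerD; first by rewrite ler_piMr // trigo.cos_max.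
  rewrite (ger0_norm hh); apply: le_trans (sin_le_id _ _ h0).
  by rewrite ler_piMl // trigo.cos_max.
pose c := trigo.cos (h *+ m); pose d := trigo.sin (h *+ m).
have cd : c ^+ 2 + d ^+ 2 = 1 by apply: trigo.cos2Dsin2.
have c2 : c ^+ 2 = 1 - d ^+ 2 by rewrite -cd addrK.
have d2 : d ^+ 2 = 1 - c ^+ 2 by rewrite -cd addrAC subrr add0r.
exists (cis R (h *+ m) ^+ 2), (a m), `|c|; split.
- rewrite -exprM mulnC exprM cisX mulrnAC hN -cisX.
  rewrite -exprM mulnC exprM.
  have -> : cis R trigo.pi ^+ 2 = 1.
    by rewrite cisX /cis trigo.cos2pi trigo.sin2pi.
  by rewrite expr1n.
- rewrite complex.normc_def /cis -/c -/d; congr (complex.real_complex R _).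
  rewrite /a -/d -[2 * _]ger0_norm ?mulr_ge0 // -sqrtr_sqr; congr Num.sqrt.
  rewrite exprMn real_normK ?num_real //= .
  transitivity ((1 - c ^+ 2 + d ^+ 2) ^+ 2 + 4 * c ^+ 2 * d ^+ 2); first by ring.
  by rewrite c2; ring.
- rewrite complex.normc_def /cis -/c -/d; congr (complex.real_complex R _).
  rewrite -[2 * _]ger0_norm ?mulr_ge0 // -sqrtr_sqr; congr Num.sqrt.
  rewrite exprMn real_normK ?num_real //= .
  transitivity ((1 - d ^+ 2 + c ^+ 2) ^+ 2 + 4 * d ^+ 2 * c ^+ 2); first by ring.
  by rewrite d2; ring.
- by rewrite (ltW am) andbT; lra.
- by rewrite normr_ge0 /a !real_normK ?num_real // addrC.
Qed.

(** * Numerical estimates *)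

(** Absorption, k C(n, k) = n C(n-1, k-1), reduces the step to (n + 1) k <= n (k + 1), that is k <=
    n. *)
Lemma bin_ge_expn n k : (k <= n)%N -> (n ^ k <= 'C(n, k) * k ^ k)%N.
Proof.
elim: k n => [|k IH] [|n] //= lekn.
have [->|k0] := posnP k; first by rewrite bin1 !muln1.
rewrite expnS [(k.+1 ^ _)%N]expnS mulnA [('C(_, _) * _)%N]mulnC -mul_bin_diag -mulnA.
rewrite leq_mul2l /= -(@leq_pmul2r (k ^ k)) ?expn_gt0 ?k0 //.
rewrite mulnAC -expnMn.
apply: (@leq_trans ((n * k.+1) ^ k)); first by rewrite leq_exp2r //; nia.
by rewrite expnMn leq_mul2r IH // orbT.
Qed.

(** With m = n - k > 0, the inverse of the right-hand side is (1 + k/m)^m <= e^k. *)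
Lemma expR_le_exprn (R : realType) n k : (k <= n)%N ->
  sequences.expR (- k%:R) <= ((n - k)%:R / n%:R) ^+ (n - k) :> R.
Proof.
move=> lekn; have [->|m0] := posnP (n - k)%N.
  by rewrite expr0 -[leRHS]exp.expR0 exp.ler_expR oppr_le0 ler0n.
set m := (n - k)%N in m0 *.
have mr0 : 0 < m%:R :> R by rewrite ltr0n.
have nE : n%:R = m%:R + k%:R :> R by rewrite -natrD subnK.
have -> : m%:R / n%:R = (1 + k%:R / m%:R)^-1 :> R.
  by rewrite nE; field; rewrite gt_eqF //= ?gt_eqF // ltr_pwDl.
rewrite exp.expRN exprVn lef_pV2 ?posrE ?exprn_gt0 ?exp.expR_gt0 //; last first.
  by rewrite ltr_pwDl // divr_ge0.
have kE : k%:R = m%:R * (k%:R / m%:R) :> R by field; rewrite gt_eqF.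
rewrite [in leRHS]kE exp.expRM_natl lerXn2r ?nnegrE ?exp.expR_ge0 //.
  by rewrite addr_ge0 // divr_ge0.
exact: exp.expR_ge1Dx.
Qed.

(** The right-hand side is the probability that a binomial variable with parameters [n] and [k / n]
    equals its mean [k]. *)
Lemma binomial_mode_bound (R : realType) n k : (0 < k <= n)%N ->
  sequences.expR (- k%:R) <=
  'C(n, k)%:R * ((k%:R / n%:R) ^+ k * ((n - k)%:R / n%:R) ^+ (n - k)) :> R.
Proof.
move=> /andP[k0 lekn]; have n0 := leq_trans k0 lekn.
rewrite mulrA -[leLHS]mul1r; apply: ler_pM => //.
- exact: exp.expR_ge0.
- rewrite expr_div_n mulrA ler_pdivlMr ?exprn_gt0 ?ltr0n // mul1r.
  by rewrite -!natrX -natrM ler_nat bin_ge_expn.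
- exact: expR_le_exprn.
Qed.

Lemma bernoulli_ineq (R : realFieldType) (x : R) k :
  x <= 1 -> 1 - k%:R * x <= (1 - x) ^+ k.
Proof.
move=> x1; elim: k => [|k IH]; first by rewrite mul0r subr0 expr0.
have x1' : 0 <= 1 - x by rewrite subr_ge0.
rewrite exprS; apply: le_trans (ler_wpM2l x1' IH).
rewrite -natr1; have := mulr_ge0 (ler0n R k) (sqr_ge0 x); nra.
Qed.

Lemma sqrtrX (R : rcfType) (x : R) m : 0 <= x -> Num.sqrt x ^+ m = Num.sqrt (x ^+ m).
Proof.
move=> x0; elim: m => [|m IH]; first by rewrite !expr0 sqrtr1.
by rewrite !exprS IH sqrtrM.
Qed.

(** At u = sqrt(k/n), v = sqrt(1 - k/n), the square of C(n, k) u^k v^(n-k) is C(n, k) times the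
    binomial probability above, giving e^(-k/2) C(n, k)^(1/2). The factor 15/16 pays for [u] being
    only near sqrt(k/n); 3/2 comes from e^(k/2) >= 1 + k/2. *)
Lemma sum_abs_krawtchouk_ge (R : realType) n k t :
  (0 < k <= n)%N -> (64 ^ 2 * (k * n) <= (2 ^ t) ^ 2)%N ->
  15 / 16 * (3 / 2) * sequences.expR (- k%:R) * Num.sqrt 'C(n, k)%:R <=
  (\sum_(r < 2 ^ t) `|(krawtchouk_class n k (2 ^ t) r)%:~R|) / (2 ^ n)%:R :> R.
Proof.
move=> /andP[k0 lekn] tkn; have n0 := leq_trans k0 lekn.
have kr0 : 0 < k%:R :> R by rewrite ltr0n.
have nr0 : 0 < n%:R :> R by rewrite ltr0n.
(* [t = 0] contradicts the size hypothesis, so [N] is even. *)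
case: t tkn => [|t] tkn; first by move: tkn; nia.
set N := (2 ^ t.+1)%N in tkn *.
have N0 : (0 < N)%N by rewrite expn_gt0.
have Nr0 : 0 < N%:R :> R by rewrite ltr0n.
pose s : R := Num.sqrt (k%:R / n%:R).
have s0 : 0 < s by rewrite sqrtr_gt0 divr_gt0.
have sge0 := ltW s0.
have s2 : s ^+ 2 = k%:R / n%:R by rewrite sqr_sqrtr // divr_ge0.
have s1 : s <= 1.
  by rewrite -[leRHS]sqrtr1 ler_wsqrtr // ler_pdivrMr // mul1r ler_nat.
have evN : ~~ odd N by rewrite /N oddX.
have s01 : 0 < s <= 1 by rewrite s0.
have [z [u [v [zN zu zv /andP[su us] [v0 uv]]]]] := root_of_unity_near R N s N0 evN s01.
apply: (@le_trans _ _ ('C(n, k)%:R * (u ^+ k * v ^+ (n - k)))); last first.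
  rewrite ler_pdivlMr ?ltr0n ?expn_gt0 //.
  apply: le_trans (sum_abs_krawtchouk_class R n k N z _ _ N0 zN zu zv).
  rewrite !exprMn -mulrA ler_wpM2l // mulrACA -exprD subnKC // natrX.
  by rewrite mulrC.
(* [4 / N <= s / (16 k)] because [s * N >= 64 k]. *)
have sN : 64 * k%:R <= s * N%:R.
  have := tkn; rewrite -(ler_nat R) !natrM -!expr2 => h.
  rewrite -(@ler_pXn2r _ 2) ?nnegrE ?mulr_ge0 // !exprMn s2.
  rewrite [leRHS]mulrAC ler_pdivlMr //.
  have -> : 64 ^+ 2 * k%:R ^+ 2 * n%:R = k%:R * (64 ^+ 2 * (k%:R * n%:R)) :> R by ring.
  by rewrite ler_pM2l.
have us1 : s * (1 - (16 * k%:R)^-1) <= u.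
  apply: le_trans su; rewrite mulrBr mulr1 lerD2l lerN2 ler_pdivrMr //.
  rewrite mulrAC ler_pdivlMr ?mulr_gt0 //; lra.
have k1 : (16 * k%:R)^-1 <= 1 :> R.
  by rewrite invf_le1 ?mulr_gt0 // -natrM ler1n muln_gt0.
have sk0 : 0 <= s * (1 - (16 * k%:R)^-1) by rewrite mulr_ge0 // subr_ge0.
have u0 : 0 <= u := le_trans sk0 us1.
have uk : 15 / 16 * s ^+ k <= u ^+ k.
  apply: (@le_trans _ _ ((s * (1 - (16 * k%:R)^-1)) ^+ k)); last first.
    by rewrite lerXn2r.
  rewrite exprMn mulrC ler_wpM2l ?exprn_ge0 //.
  apply: le_trans (bernoulli_ineq _ _ k k1).
  have -> : k%:R * (16 * k%:R)^-1 = 16^-1 :> R by field; rewrite gt_eqF.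
  lra.
(* Approximating [s] from below makes [v] err upwards, so it costs nothing. *)
have vk : Num.sqrt ((n - k)%:R / n%:R) <= v.
  rewrite -(ger0_norm v0) -sqrtr_sqr ler_wsqrtr //.
  have -> : v ^+ 2 = 1 - u ^+ 2 by rewrite -uv addrAC subrr add0r.
  have -> : (n - k)%:R / n%:R = 1 - s ^+ 2 :> R.
    by rewrite s2 natrB //; field; rewrite gt_eqF.
  by rewrite lerD2l lerN2 lerXn2r.
apply: (@le_trans _ _ ('C(n, k)%:R * (15 / 16 * s ^+ k *
   Num.sqrt ((n - k)%:R / n%:R) ^+ (n - k)))); last first.
  rewrite ler_wpM2l //; apply: ler_pM => //.
  - by rewrite mulr_ge0 ?exprn_ge0 //; lra.
  - by rewrite exprn_ge0 ?sqrtr_ge0.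
  - by rewrite lerXn2r ?nnegrE ?sqrtr_ge0.
rewrite /s !sqrtrX ?divr_ge0 //.
set P := _ ^+ k; set Q := _ ^+ (n - k).
have P0 : 0 <= P by rewrite exprn_ge0 ?divr_ge0.
have Q0 : 0 <= Q by rewrite exprn_ge0 ?divr_ge0.
have CPQ := binomial_mode_bound R n k; rewrite k0 lekn -/P -/Q in CPQ.
have {}CPQ := CPQ isT.
set C : R := 'C(n, k)%:R in CPQ *.
have C0 : 0 <= C by rewrite ler0n.
have -> : C * (15 / 16 * Num.sqrt P * Num.sqrt Q) =
          15 / 16 * Num.sqrt (C * (P * Q)) * Num.sqrt C.
  by rewrite !sqrtrM ?mulr_ge0 // -[in LHS](sqr_sqrtr C0); ring.
rewrite ler_wpM2r ?sqrtr_ge0 // -mulrA ler_wpM2l ?divr_ge0 //.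
apply: le_trans (ler_wsqrtr CPQ).
(* [e^(-k) = (e^(-k/2))^2] and [e^(-k/2) <= 2/3]. *)
pose e : R := sequences.expR (- (k%:R / 2)).
have eE : sequences.expR (- k%:R) = e ^+ 2.
  by rewrite /e -exp.expRM_natl; congr sequences.expR; field.
have e0 : 0 <= e by apply: exp.expR_ge0.
have e1 : 3 / 2 * e <= 1.
  rewrite /e exp.expRN ler_pdivrMr ?exp.expR_gt0 // mul1r.
  apply: le_trans (exp.expR_ge1Dx _).
  have : 1 <= k%:R :> R by rewrite ler1n.
  lra.
rewrite eE sqrtr_sqr ger0_norm // expr2 mulrA -[leRHS]mul1r.
by rewrite ler_wpM2r.
Qed.

(** * The theorem *)

(** The bounds differ by a factor 4, so a power of 4 lies between them. *)
Lemma exists_pow2_sqr m : (0 < m)%N ->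
  exists t, (64 ^ 2 * m <= (2 ^ t) ^ 2 <= 128 ^ 2 * m)%N.
Proof.
move=> m0; exists (trunc_log 4 (128 ^ 2 * m)).
have := trunc_log_bounds (isT : (1 < 4)%N) (_ : 0 < 128 ^ 2 * m)%N.
rewrite muln_gt0 m0 => /(_ isT).
have -> : (128 ^ 2 * m = 4 * (64 ^ 2 * m))%N by rewrite mulnA.
set T := trunc_log _ _; have -> : ((2 ^ T) ^ 2 = 4 ^ T)%N by rewrite expnAC.
by rewrite /= [(4 ^ T.+1)%N]expnS ltn_pmul2l // => /andP[-> /ltnW ->].
Qed.

(** [2 ^ s] is the largest power of two below both [n.+1] and [2 ^ t], so that degree [2 ^ s - 1] is
    available in [n] variables and the first [2 ^ s] weights are distinct residues. The bound 8
    limits the cost of a flip to 1/8 of the mass. *)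
Lemma exists_pow2_weight k n t : (0 < k <= n)%N -> (64 ^ 2 * (k * n) <= (2 ^ t) ^ 2)%N ->
  exists s, [/\ (2 ^ s <= n.+1)%N, (2 ^ s <= 2 ^ t)%N,
    (6 < n)%N -> (8 <= 2 ^ s)%N & (k * n <= 4 * (2 ^ s).-1 ^ 2)%N].
Proof.
move=> /andP[k0 lekn] tkn.
have /andP[l1 l2] := trunc_log_bounds (isT : (1 < 2)%N) (ltn0Sn n).
have N64 : (64 <= 2 ^ t)%N by nia.
have [le|lt] := leqP (trunc_log 2 n.+1) t.
  exists (trunc_log 2 n.+1); split=> //; first by rewrite leq_exp2l.
    by move=> n6; rewrite (@leq_exp2l 2 3) // trunc_log_max.
  by move: l2; rewrite expnS; set M := (2 ^ _)%N in l1 *; nia.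
exists t; split=> //.
- by apply: leq_trans l1; rewrite leq_exp2l // ltnW.
- by move=> _; apply: leq_trans N64.
- by nia.
Qed.

(** Serves to exclude degree 0 by positivity of the level-[k] mass. *)
Lemma L1_degree0 (R : realType) n k (p : {mpoly 'F_2[n]}) :
  (0 < k)%N -> f2degree p = 0%N -> L1 k (f2fun R p) = 0.
Proof.
move=> k0 p0; have [c pc] : exists c, p = c%:MP.
  exists p@_0; apply: msize1_polyC.
  by move: p0; rewrite /f2degree; case: (msize p) => [|[|]].
rewrite /L1 big1 // => S /eqP cS; rewrite /fourier.
suff -> : \sum_(x : cube n) f2fun R p x * (-1) ^+ (\sum_(i in S) x i)%N = 0.
  by rewrite mul0r normr0.
have fc x : f2fun R p x = (c != 0)%:R by rewrite /f2fun /f2eval pc mevalC.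
under eq_bigr do rewrite fc.
rewrite -mulr_sumr; have := character_sum R n S 1.
under eq_bigr do rewrite expr1n mulr1.
by rewrite subrr cS expr0n gtn_eqF // mul0r => ->; rewrite mulr0.
Qed.

Lemma F2_of_bool_neq0 (b : bool) : (b%:R != 0 :> 'F_2) = b.
Proof. by case: b. Qed.

Lemma exists_selection (R : realType) n k t : (0 < k <= n)%N ->
  (64 ^ 2 * (k * n) <= (2 ^ t) ^ 2)%N ->
  exists f : nat -> bool,
  (f2degree (sympoly n (fun w => (f (w %% 2 ^ t)%N)%:R)) != 0%N ->
   k * n <= 36 * f2degree (sympoly n (fun w => (f (w %% 2 ^ t)%N)%:R)) ^ 2)%N /\
  3 / 8 * (\sum_(r < 2 ^ t) `|(krawtchouk_class n k (2 ^ t) r)%:~R|)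
  <= \sum_(r < 2 ^ t) (krawtchouk_class n k (2 ^ t) r)%:~R * (f r)%:R :> R.
Proof.
move=> kn tkn; have [k0 lekn] := andP kn.
have N0 : (0 < 2 ^ t)%N by rewrite expn_gt0.
pose a r : R := (krawtchouk_class n k (2 ^ t) r)%:~R.
have a0 : \sum_(r < 2 ^ t) a r = 0 by apply: sum_krawtchouk_class0.
have A0 : 0 <= \sum_(r < 2 ^ t) `|a r| by apply: sumr_ge0.
(* For [n <= 6], [k * n <= 36], so any nonzero degree suffices and nothing is flipped. *)
have [n6|n6] := leqP n 6.
  exists (fun r => 0 < a r); split; last by rewrite (sum_positive_part R _ a) //; lra.
  by move: (f2degree _) => d d0; nia.
have [s [sn st /(_ n6) s8 kns]] := exists_pow2_weight k n t kn tkn.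
have [|f [fs fA]] := odd_selection R (2 ^ t) (2 ^ s) a _ a0.
  by rewrite st expn_gt0.
exists f; split.
  move=> _; set F := fun w => _.
  suff : ((2 ^ s).-1 <= f2degree (sympoly n F))%N by move: (f2degree _) => d; nia.
  apply: f2degree_sympoly_ge; first by lia.
  rewrite iter_fdiff_pred_exp2; apply: contra fs => /eqP fs; apply/eqP.
  rewrite -[RHS]fs; apply: eq_bigr => r _.
  by rewrite /F add0n modn_small // (leq_trans (ltn_ord r)).
(* 3/8 is 1/2 - 1/8. *)
apply: le_trans fA; rewrite mulrC ler_wpM2l //.
suff : (2 ^ s)%:R^-1 <= 8^-1 :> R by lra.
by rewrite lef_pV2 ?posrE ?ltr0n ?expn_gt0 // ler_nat.
Qed.

Lemma ler_sqrt_sqr (R : rcfType) (x y : R) : 0 <= y -> x <= y ^+ 2 -> Num.sqrt x <= y.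
Proof. by move=> y0 /ler_wsqrtr; rewrite sqrtr_sqr ger0_norm. Qed.

Lemma ler_sqr_sqrt (R : rcfType) (x y : R) : 0 <= y -> y ^+ 2 <= x -> y <= Num.sqrt x.
Proof. by move=> y0 /ler_wsqrtr; rewrite sqrtr_sqr ger0_norm. Qed.

(** Square root of k^k n^k <= k^(2k) C(n, k), which is [bin_ge_expn] times k^k. *)
Lemma sqrt_exp_le_bin (R : rcfType) n k : (k <= n)%N ->
  Num.sqrt (k * n)%:R ^+ k <= k%:R ^+ k * Num.sqrt 'C(n, k)%:R :> R.
Proof.
move=> lekn; rewrite sqrtrX //; apply: ler_sqrt_sqr.
  by rewrite mulr_ge0 ?exprn_ge0 ?sqrtr_ge0.
rewrite exprMn sqr_sqrtr // -!natrX -natrM ler_nat expnMn -mulnn.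
by rewrite -mulnA leq_mul2l mulnC bin_ge_expn ?orbT.
Qed.

Theorem theorem1p9 (R : realType) :
  exists c C : R, [/\ 0 < c, 0 < C &
  forall k : nat, (0 < k)%N ->
  exists2 ck : R, 0 < ck &
  forall n : nat, (k <= n)%N ->
  exists p : {mpoly 'F_2[n]},
    let d := f2degree p in
    [/\ multilinear p /\ f2symmetric p,
        c * Num.sqrt (k * n)%:R <= d%:R <= C * Num.sqrt (k * n)%:R,
        sequences.expR (- k%:R) / 2 * Num.sqrt 'C(n, k)%:R <= L1 k (f2fun R p) &
        ck * d%:R ^+ k <= sequences.expR (- k%:R) / 2 * Num.sqrt 'C(n, k)%:R]].
Proof.
(* 6 is the square root of the 36 in [exists_selection]; 128 bounds [2 ^ t / sqrt (k n)]. *)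
exists 6^-1, 128; split=> [||k k0]; rewrite ?invr_gt0 //.
have kr0 : 0 < k%:R :> R by rewrite ltr0n.
have e0 : 0 < sequences.expR (- k%:R) / 2 :> R by rewrite divr_gt0 // exp.expR_gt0.
have K0 : 0 < (128 * k%:R) ^+ k :> R by rewrite exprn_gt0 // mulr_gt0.
(* From d <= 128 sqrt(kn) and sqrt(kn)^k <= k^k C(n, k)^(1/2). *)
exists (sequences.expR (- k%:R) / 2 / (128 * k%:R) ^+ k); first by rewrite divr_gt0.
move=> n lekn; have n0 := leq_trans k0 lekn.
have kn : (0 < k <= n)%N by rewrite k0.
have [t /andP[t1 t2]] :
    exists t, (64 ^ 2 * (k * n) <= (2 ^ t) ^ 2 <= 128 ^ 2 * (k * n))%N.
  by apply: exists_pow2_sqr; rewrite muln_gt0 k0.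
have N0 : (0 < 2 ^ t)%N by rewrite expn_gt0.
have [f [fd fA]] := exists_selection R n k t kn t1.
set F := fun w => _ in fd; exists (sympoly n F) => /=.
have perF w : F (w + 2 ^ t)%N = F w by rewrite /F modnDr.
have dN := f2degree_sympoly_lt n F t perF.
have C0 : 0 < Num.sqrt 'C(n, k)%:R :> R by rewrite sqrtr_gt0 ltr0n bin_gt0.
have L1p :
    sequences.expR (- k%:R) / 2 * Num.sqrt 'C(n, k)%:R <= L1 k (f2fun R (sympoly n F)).
  have evF x : f2eval (sympoly n F) x = F (hamming_weight x %% 2 ^ t)%N.
    by rewrite f2eval_sympoly /F modn_mod.
  apply: le_trans (L1_krawtchouk_class R n k (2 ^ t) _ F N0 evF).
  have Fr (r : 'I_(2 ^ t)) : (F r != 0) = f r.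
    by rewrite /F modn_small // F2_of_bool_neq0.
  under eq_bigr do rewrite Fr.
  apply: (@le_trans _ _ (3 / 8 * ((\sum_(r < 2 ^ t)
      `|(krawtchouk_class n k (2 ^ t) r)%:~R|) / (2 ^ n)%:R))); last first.
    by rewrite mulrA ler_wpM2r // invr_ge0.
  (* The constants multiply to 3/8 * 15/16 * 3/2 = 135/256 > 1/2. *)
  have := sum_abs_krawtchouk_ge R n k t kn t1.
  have := mulr_gt0 e0 C0; rewrite -!mulrA.
  set E := sequences.expR _; set Q := Num.sqrt _; set A := _ / _.
  by have := mulrCA 2^-1 E Q; lra.
have {}fd : (k * n <= 36 * f2degree (sympoly n F) ^ 2)%N.
  apply: fd; apply/eqP => d0; have := lt_le_trans (mulr_gt0 e0 C0) L1p.
  by rewrite L1_degree0 // ltxx.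
have d_le : (f2degree (sympoly n F))%:R <= 128 * Num.sqrt (k * n)%:R :> R.
  rewrite -ler_pdivrMl //; apply: ler_sqr_sqrt; first by rewrite mulr_ge0 // invr_ge0.
  rewrite exprMn exprVn ler_pdivrMl ?exprn_gt0 // -!natrX -natrM ler_nat.
  by apply: leq_trans t2; rewrite leq_exp2r // ltnW.
split=> //.
- by split; [apply: sympoly_multilinear|apply: sympoly_symmetric].
- rewrite d_le andbT ler_pdivrMl //; apply: ler_sqrt_sqr; first by rewrite mulr_ge0.
  by rewrite exprMn -!natrX -natrM ler_nat.
- rewrite -mulrA ler_pM2l // ler_pdivrMl // exprMn.
  apply: (@le_trans _ _ ((128 * Num.sqrt (k * n)%:R) ^+ k)).
    by rewrite lerXn2r ?nnegrE // mulr_ge0 ?sqrtr_ge0.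
  by rewrite exprMn -mulrA ler_pM2l ?exprn_gt0 // sqrt_exp_le_bin.
Qed.
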